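(* Assume the Generalized Continuum Hypothesis. Let $G$ be a paratopological group. If $G$ contains a subspace homeomorphic to a stationary subset of some uncountable regular cardinal, then $G$ is not hereditarily normal.
   Context: All spaces are Tychonoff. A paratopological group is a group endowed with a topology for which the group multiplication $G\times G\to G$ is (jointly) continuous. Subsets of ordinals carry the subspace topology of the order topology. A subset of a regular uncountable cardinal $\kappa$ is stationary if it meets every closed unbounded subset of $\kappa$. *)

(* Defs.v *)
From HB Require Import structures.
From mathcomp Require Import all_boot all_order all_algebra.
From mathcomp Require Import all_classical all_reals all_analysis.
Set Implicit Arguments. Unset Strict Implicit. Unset Printing Implicit Defensive.
Import Order.TTheory GRing.Theory Num.Theory.
Local Open Scope classical_set_scope.

Definition inj_into (A B : Type) : Prop := exists f : A -> B, injective f.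

Definition GCH : Prop :=
  forall A B : Type, inj_into nat A -> inj_into A B -> inj_into B (set A) ->
    inj_into B A \/ inj_into (set A) B.

Definition group_axioms (G : Type) (mul : G -> G -> G) (one : G) (inv : G -> G) :=
  [/\ associative mul, left_id one mul, right_id one mul,
      (forall x, mul (inv x) x = one) & (forall x, mul x (inv x) = one)].

Definition paratopological_group (G : topologicalType)
  (mul : G -> G -> G) (one : G) (inv : G -> G) :=
  group_axioms mul one inv /\ continuous (fun p : G * G => mul p.1 p.2).

Definition tychonoff_space (G : topologicalType) :=
  accessible_space G /\ completely_regular_space G.

Definition hereditarily_normal (G : topologicalType) :=
  forall A : set G, normal_space (subspace A).

Definition well_ordered d (K : orderType d) :=
  forall S : set K, S !=set0 -> exists x, S x /\ forall y, S y -> (x <= y)%O.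

(* K is (the order type of) a regular uncountable cardinal:
   a well-order which is an initial ordinal (no injection into a proper
   initial segment), uncountable, and of cofinality itself (every cofinal
   subset has cardinality |K|). *)
Definition regular_uncountable_cardinal d (K : orderType d) :=
  [/\ well_ordered K,
      (forall x : K, ~ exists f : K -> K, injective f /\ forall y, (f y < x)%O),
      ~ inj_into K nat &
      (forall S : set K, (forall x, exists y, S y /\ (x <= y)%O) ->
         exists f : K -> K, injective f /\ forall y, S (f y))].

Definition club d (K : orderType d) (C : set (order_topology K)) :=
  closed C /\ forall x : K, exists y, C y /\ (x <= y)%O.

Definition stationary d (K : orderType d) (S : set (order_topology K)) :=
  forall C, club C -> C `&` S !=set0.

Definition embeds_in (X Y : topologicalType) (S : set X) :=
  exists f : X -> Y, [/\ {within S, continuous f}, {in S &, injective f} &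
    (forall U : set X, open U ->
       exists W : set Y, open W /\ f @` (S `&` U) = f @` S `&` W)].

(* Main.v *)
Require Import Defs.
From HB Require Import structures.
From mathcomp Require Import all_boot all_order all_algebra.
From mathcomp Require Import all_classical all_reals all_analysis.
Set Implicit Arguments. Unset Strict Implicit. Unset Printing Implicit Defensive.
Import Order.TTheory.
Local Open Scope classical_set_scope.

(* Let x : S -> G be the embedding and a0 in S a limit point of S. The rows b_g = x_g S, for
   g < a0 in S, accumulate on the row y = x_a0 S, and by joint continuity an open set
   containing cofinally many points of y meets any open set containing all far enough tails
   of the rows b_g. Hence it is enough to thin the points y_i to an unbounded family A, and
   the points b_g(s) to s in a club trace, forming B, so that A and B are separated (neither
   meets the closure of the other): hereditary normality would then separate them by open
   sets, which is absurd.
   That y_i is not adherent to the tails of B follows from the regularity of G and the fact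
   that two clubs meet on S; that b_g(s) is not adherent to {y_i : i < s} follows from y_i
   -> y_s <> b_g(s); the remaining initial parts have fewer than |K| points, and GCH enters
   through Jones' lemma, which says that the closure of such a set contains only a bounded
   part of each row. *)

(** * Combinatorics of a regular uncountable cardinal *)

Section RegularCardinal.
Context d (K : orderType d) (regK : regular_uncountable_cardinal K).
Local Open Scope order_scope.

Definition unbounded (T : set K) := forall m, exists t, T t /\ m < t.

Definition initial_segment (l : K) := {g : K | g < l}.

Lemma wf_lt : well_founded (fun x y : K => x < y).
Proof.
case: regK => wo _ _ _ x; apply: contrapT => nx.
have [y [/= ny ymin]] := wo [set x | ~ Acc (fun x y : K => x < y) x] (ex_intro _ x nx).
apply: ny; constructor => z zy; apply: contrapT => nz.
by have := ymin z nz; rewrite leNgt zy.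
Qed.

Lemma segment_not_inj l : ~ inj_into K (initial_segment l).
Proof.
case: regK => _ ini _ _ [f finj]; apply: (ini l).
exists (fun y => sval (f y)); split; last by move=> y; exact: (svalP (f y)).
by move=> a b /val_inj; exact: finj.
Qed.

Lemma no_max (x : K) : exists y, x < y.
Proof.
case: regK => _ _ unc cof; apply: contrapT => nx; apply: unc.
(* A maximum [x] would make the singleton of [x] cofinal, so that [K] would inject into a point. *)
have [z|f [finj fx]] := cof [set x].
  exists x; split=> //; rewrite leNgt; apply/negP => xz.
  by apply: nx; exists z.
by exists (fun=> 0%N) => a b _; apply: finj; rewrite !fx.
Qed.

Lemma regular_inhabited : exists k : K, True.
Proof.
case: regK => _ _ unc _; apply: contrapT => nk; apply: unc.
by exists (fun=> 0%N) => a; case: nk; exists a.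
Qed.

(** An unbounded range is cofinal, hence of size |K| by regularity; choosing preimages then injects
    [K] into [I]. *)
Lemma not_inj_bounded (I : Type) (f : I -> K) :
  ~ inj_into K I -> exists b, forall i, f i < b.
Proof.
case: regK => _ _ _ cof nI; apply: contrapT => nb; apply: nI.
have [x|g [ginj gf]] := cof (range f).
  apply: contrapT => nx; apply: nb; exists x => i.
  rewrite ltNge; apply/negP => xi; apply: nx.
  by exists (f i); split=> //; exists i.
have [h hP] := @choice K I (fun y i => f i = g y)
  (fun y => let: ex_intro2 i _ e := gf y in ex_intro _ i e).
by exists h => a b eab; apply: ginj; rewrite -!hP eab.
Qed.

Lemma segment_bounded (l : K) (f : K -> K) :
  exists b, forall g, g < l -> f g < b.
Proof.
have [b bP] := not_inj_bounded (fun i : initial_segment l => f (sval i))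
  (@segment_not_inj l).
by exists b => g gl; exact: (bP (exist _ g gl)).
Qed.

Lemma segment_union_bounded (l : K) (P : K -> K -> Prop) :
  (forall g, g < l -> exists b, forall a, P g a -> a <= b) ->
  exists b, forall g a, g < l -> P g a -> a <= b.
Proof.
move=> hP.
have /choice[f fP] : forall g, exists b, g < l -> forall a, P g a -> a <= b.
  move=> g; have [/hP[b bP]|_] := ltP g l; first by exists b.
  by exists l.
have [b bP] := segment_bounded l f.
by exists b => g a gl /(fP g gl) /le_trans; apply; exact/ltW/bP.
Qed.

Lemma nat_bounded (u : nat -> K) : exists b, forall n, u n < b.
Proof. by apply: not_inj_bounded; case: regK. Qed.

Lemma unbounded_inj (T : set K) : unbounded T ->
  exists f : K -> K, injective f /\ forall y, T (f y).
Proof.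
case: regK => _ _ _ cof uT; apply: cof => x.
by have [t [Tt /ltW xt]] := uT x; exists t.
Qed.

Lemma bounded_or_unbounded (T : set K) :
  (exists b, forall t, T t -> t <= b) \/ unbounded T.
Proof.
have [?|nT] := pselect (exists b, forall t, T t -> t <= b); first by left.
right=> m; apply: contrapT => nm; apply: nT; exists m => t Tt.
by rewrite leNgt; apply/negP => mt; apply: nm; exists t.
Qed.

(* Transfinite recursion along K, picking each time an element of A not yet used, until A is
   exhausted. *)
Lemma inj_comparable (A : Type) : inj_into A K \/ inj_into K A.
Proof.
have /choice[pick pickP] : forall X : set A, exists o : option A,
    if o is Some a then X a else forall a, ~ X a.
  move=> X; have [[a Xa]|nX] := pselect (exists a, X a); first by exists (Some a).
  by exists None => a Xa; apply: nX; exists a.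
pose F (k : K) (rec : forall j : K, j < k -> option A) :=
  pick [set a | forall (j : K) (jk : j < k), rec j jk <> Some a].
pose g := Fix wf_lt (fun=> option A) F.
have gE k : g k = pick [set a | forall j, j < k -> g j <> Some a].
  rewrite /g Fix_eq // => x f1 f2 e; congr (F x _).
  by apply: functional_extensionality_dep => y; apply: functional_extensionality_dep.
have [[k gk]|allS] := pselect (exists k, g k = None).
  left; have used a : exists j, g j = Some a.
    have := pickP [set a | forall j, j < k -> g j <> Some a].
    rewrite -gE gk => /(_ a) na; apply: contrapT => nj; apply: na => j _ e.
    by apply: nj; exists j.
  have /choice[f fP] := used.
  by exists f => a b e; have := fP a; rewrite e fP => -[].
right; have /choice[f fP] : forall k, exists a, g k = Some a.
  by move=> k; case e : (g k) => [a|]; [exists a | case: allS; exists k].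
have neq j k : j < k -> f j <> f k.
  move=> jk e; have := pickP [set a | forall j, j < k -> g j <> Some a].
  by rewrite -gE fP => /(_ j jk); rewrite fP e.
exists f => a b e; have [/neq|/neq|//] := ltgtP a b; first by [].
by move=> /(_ (esym e)).
Qed.

(** Cut [K] into fibres of the first coordinate. There are fewer than |K| of them, so by regularity
    one is unbounded and has size |K|; the second coordinate injects it into the segment. *)
Lemma square_not_inj l :
  ~ inj_into K (initial_segment l * initial_segment l).
Proof.
move=> [f finj].
have [g gl|b bP] := @segment_union_bounded l (fun g k => sval (f k).1 = g).
  have [//|uF] := bounded_or_unbounded [set k | sval (f k).1 = g].
  have [h [hinj hP]] := unbounded_inj uF; case: (@segment_not_inj l).
  exists (fun k => (f (h k)).2) => a c e; apply/hinj/finj.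
  rewrite (surjective_pairing (f (h a))) (surjective_pairing (f (h c))) e.
  by congr pair; apply: val_inj; rewrite /= hP hP.
have [k bk] := no_max b.
by have := bP _ k (svalP (f k).1) erefl; rewrite leNgt bk.
Qed.

Definition closed_under (F : K -> K) s := forall m, m < s -> F m < s.

(** Iterate from [x] a step [N] that dominates [F] on initial segments; the least strict upper bound
    of the countably many iterates is closed under [F]. *)
Lemma closed_under_unbounded (F : K -> K) : unbounded (closed_under F).
Proof.
case: regK => wo _ _ _ x.
have /choice[N NP] : forall m, exists n, m < n /\ forall g, g <= m -> F g < n.
  move=> m; have [m1 mm1] := no_max m.
  have [b bP] := segment_bounded m1 F.
  have := leP b m; case=> [bm|mb]; last first.
    by exists b; split=> // g gm; apply: bP; apply: le_lt_trans mm1.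
  exists m1; split=> // g gm; apply: (lt_trans (bP _ _)).
    exact: le_lt_trans mm1.
  exact: le_lt_trans mm1.
pose u n := iter n N x.
have [s [us smin]] : exists s, (forall n, u n < s) /\
    forall t, (forall n, u n < t) -> s <= t.
  by have [b bP] := nat_bounded u; apply: (wo [set s | forall n, u n < s]); exists b.
exists s; split; last exact: (us 0%N).
move=> m ms.
have [n mn] : exists n, m <= u n.
  apply: contrapT => nn; suff : s <= m by rewrite leNgt ms.
  by apply: smin => n; rewrite ltNge; apply/negP => mn; apply: nn; exists n.
by apply: (lt_trans _ (us n.+1)); apply: (NP (u n)).2.
Qed.

(** The points beyond [m0] closed under [F] form a club. This is the only way in which stationarity
    is exploited below. *)
Lemma stationary_closed_under (S : set (order_topology K)) (F : K -> K) (m0 : K) :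
  stationary S -> exists s, [/\ S s, m0 < s & closed_under F s].
Proof.
case: regK => wo _ _ _ stS.
pose C : set (order_topology K) := [set s | m0 < s /\ closed_under F s].
suff : club C by move=> /stS[s [[? ?] ?]]; exists s.
split; last first.
  move=> x; have [s [? xs]] := closed_under_unbounded F (Order.max x m0).
  by exists s; split; [split=> //; apply: le_lt_trans xs; rewrite le_max lexx orbT
    | apply/ltW; apply: le_lt_trans xs; rewrite le_max lexx].
move=> p clp.
(* The successor [p'] of [p] turns the half-closed interval from [m] to [p] into an open
   neighbourhood of [p]. *)
have [p' [pp' p'min]] : exists p', p < p' /\ forall t, p < t -> p' <= t.
  by have [q pq] := no_max p; apply: (wo [set q | p < q]); exists q.
have le_p t : t < p' -> t <= p by rewrite leNgt => tp; apply/negP => /p'min; rewrite leNgt tp.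
have lp := @lray_open _ (order_topology K) p'.
have mp' m := @itv_open _ (order_topology K) m p'.
split.
  have [|t [[m0t _] /=]] := clp _ (open_nbhs_nbhs (conj lp _)).
    by rewrite /= in_itv.
  by rewrite in_itv /= => /le_p; exact: lt_le_trans.
move=> m mp.
have [|t [[_ ct] /=]] := clp _ (open_nbhs_nbhs (conj (mp' m) _)).
  by rewrite /= in_itv /= mp pp'.
rewrite in_itv /= => /andP[mt /le_p tp].
by apply: lt_le_trans tp; exact: ct.
Qed.

End RegularCardinal.

(** * Separation in hereditarily normal spaces *)

Lemma notin_closureP (G : topologicalType) (A : set G) g :
  ~ closure A g <-> exists W, [/\ open W, W g & forall h, A h -> ~ W h].
Proof.
split=> [ng|[W [oW Wg AW]] /(_ W)].
  exists (~` closure A); split=> //; first by apply/closed_openC; exact: closed_closure.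
  by move=> h Ah nh; exact/nh/subset_closure.
by case=> [|h [/AW]//]; apply: open_nbhs_nbhs.
Qed.

(** In the open subspace [Y] the closures of [A] and [B] become disjoint, so normality of [Y]
    separates them; sets open in [Y] are open in [G]. *)
Lemma hereditarily_normal_separated (G : topologicalType) (A B : set G) :
  hereditarily_normal G ->
  (forall g, A g -> ~ closure B g) -> (forall g, B g -> ~ closure A g) ->
  exists U V, [/\ open U, open V, A `<=` U, B `<=` V &
    forall g, U g -> ~ V g].
Proof.
move=> hn AB BA; pose Y : set G := ~` (closure A `&` closure B).
have oY : open Y by apply: closed_openC; apply: closedI; exact: closed_closure.
have cA : closed (closure A `&` Y : set (subspace Y)).
  apply: closedI; last exact: closed_subspaceT.
  by apply: closed_subspaceW; exact: closed_closure.
have [C sC CB] : exists2 C : set (subspace Y),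
    set_nbhs (closure A `&` Y : set (subspace Y)) C &
    closure C `<=` ~` (closure B : set G).
  apply: (hn Y _ cA (~` closure B)).
  apply/set_nbhsP; exists (~` closure B); split=> //.
    by apply/open_subspaceW/closed_openC; exact: closed_closure.
  by move=> g [Ag Yg] Bg; exact: Yg.
have [W [oW AW WC]] := (set_nbhsP _ _).1 sC.
exists ((W : set G) `&` Y), (~` closure (C : set (subspace Y)) `&` Y); split.
- by rewrite open_setIS.
- by rewrite open_setIS //; apply/closed_openC; exact: closed_closure.
- move=> g Ag; have Yg : Y g by case=> _; exact: AB.
  by split=> //; apply: AW; split=> //; exact: subset_closure.
- move=> g Bg; split; last by case=> + _; exact: BA.
  by move=> /CB; apply; exact: subset_closure.
- by move=> g [/WC Cg _] [+ _]; apply; exact: subset_closure.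
Qed.

Lemma accessible_closure_set1 (G : topologicalType) (g : G) :
  accessible_space G -> closure [set g] = [set g].
Proof.
by move=> T1; apply/esym/closure_id; exact: (accessible_closed_set1 T1).
Qed.

Lemma separated_points (G : topologicalType) (g h : G) :
  hereditarily_normal G -> accessible_space G -> g <> h ->
  exists U V, [/\ open U, open V, U g, V h & forall k, U k -> ~ V k].
Proof.
move=> hn T1 gh; have cl (k : G) := accessible_closure_set1 k T1.
have [|_ ->|U [V [oU oV gU hV UV]]] :=
  @hereditarily_normal_separated G [set g] [set h] hn.
- by rewrite cl => _ ->.
- by rewrite cl => /esym.
by exists U, V; split=> //; [exact: gU | exact: hV].
Qed.

Lemma shrink_nbhs (G : topologicalType) (O : set G) g :
  hereditarily_normal G -> accessible_space G -> open O -> O g ->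
  exists U, [/\ open U, U g & closure U `<=` O].
Proof.
move=> hn T1 oO Og; have cl := accessible_closure_set1 g T1.
have [|h nO|U [V [oU oV gU OV UV]]] :=
  @hereditarily_normal_separated G [set g] (~` O) hn.
- by move=> _ ->; rewrite -(closure_id _).1 //; exact: open_closedC.
- by rewrite cl => e; apply: nO; rewrite e.
exists U; split=> //; first exact: gU.
move=> h Uh; apply: contrapT => /OV Vh.
have [|k [Uk Vk]] := Uh V; first exact: open_nbhs_nbhs.
exact: (UV k).
Qed.

(** * Families indexed by a stationary set, and Jones' lemma *)

Section StationaryFamilies.
Context d (K : orderType d) (G : topologicalType).
Hypothesis regK : regular_uncountable_cardinal K.
Hypothesis hnG : hereditarily_normal G.
Hypothesis T1G : accessible_space G.
Variable S : set (order_topology K).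
Hypothesis statS : stationary S.
Local Open Scope order_scope.
Implicit Types (y z : K -> G) (O W : set G).

(* At points of S other than the least element of K, this is continuity in the order
   topology of S. *)
Definition left_continuous y := forall s W m, S s -> open W -> W (y s) ->
  m < s -> exists b, [/\ m <= b, b < s &
    forall t, S t -> b < t -> t <= s -> W (y t)].

(** Continuity of the inverse of [y], tested on the open intervals of points above [m] and at most
    [s]. *)
Definition left_discrete y := forall s m, S s -> m < s ->
  exists W, [/\ open W, W (y s) & forall t, S t -> W (y t) -> m < t /\ t <= s].

Definition tail_avoids y W b := forall i, S i -> b < i -> ~ W (y i).

Definition tail_free y g := exists W b, [/\ open W, W g & tail_avoids y W b].

Lemma left_discrete_inj y s t : left_discrete y -> S s -> S t ->
  y s = y t -> s = t.
Proof.
move=> dy; wlog st : s t / s < t.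
  move=> h Ss St e; have [st|ts|//] := ltgtP s t; first exact: h.
  by apply/esym; exact: h.
move=> Ss St e; have [W [_ Wt]] := dy t s St st.
by move=> /(_ s Ss); rewrite e => /(_ Wt)[]; rewrite ltxx.
Qed.

(* Two closed unbounded subsets of S meet, so the tails of y cannot visit both O1 and the
   complement of O. *)
Lemma tail_avoids_shrunk y O O1 : left_continuous y -> open O ->
  closure O1 `<=` O -> unbounded [set i | S i /\ ~ O (y i)] ->
  exists b, tail_avoids y O1 b.
Proof.
move=> cy oO O1O u1.
have [[b bP]|u2] := bounded_or_unbounded [set i | S i /\ O1 (y i)].
  by exists b => i Si bi Oi; have := bP i (conj Si Oi); rewrite leNgt bi.
have /choice[F1 F1P] := u1; have /choice[F2 F2P] := u2.
have [k0 _] := regular_inhabited regK.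
have [s [Ss k0s cs]] :=
  stationary_closed_under regK (fun m => Order.max (F1 m) (F2 m)) k0 statS.
have c1 m : m < s -> F1 m < s by move=> /cs; rewrite gt_max => /andP[].
have c2 m : m < s -> F2 m < s by move=> /cs; rewrite gt_max => /andP[].
exfalso; have [Os|nOs] := pselect (O (y s)).
  have [b [_ bs /(_ (F1 b))]] := cy s O k0 Ss oO Os k0s.
  have [[SF nO] bF] := F1P b.
  by move=> /(_ SF bF (ltW (c1 _ bs))).
have nc : (~` closure O1) (y s) by move=> /O1O.
have [b [_ bs /(_ (F2 b))]] := cy s _ k0 Ss
  (closed_openC (@closed_closure _ O1)) nc k0s.
have [[SF OF] bF] := F2P b.
by move=> /(_ SF bF (ltW (c2 _ bs))); apply; exact: subset_closure.
Qed.

(** At most one point adheres to all tails of [y]: either a tail stays in [U] and misses [V], or [U]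
    is left unboundedly often and a smaller neighbourhood of [g] misses a tail. *)
Lemma tail_free_or y g h : left_continuous y -> g <> h ->
  tail_free y g \/ tail_free y h.
Proof.
move=> cy gh; have [U [V [oU oV Ug Vh UV]]] := separated_points hnG T1G gh.
have [[b bP]|u] := bounded_or_unbounded [set i | S i /\ ~ U (y i)].
  right; exists V, b; split=> // i Si bi Vi.
  suff : i <= b by rewrite leNgt bi.
  by apply: bP; split=> // /UV.
left; have [U1 [oU1 U1g U1U]] := shrink_nbhs hnG T1G oU Ug.
have [b bP] := tail_avoids_shrunk cy oU U1U u.
by exists U1, b.
Qed.

(** The single exceptional point is a value of the injective family [z] at one index [i0] at most;
    [k0] is a default bound. *)
Lemma eventually_tail_free y z (k0 : K) : left_continuous y -> left_discrete z ->
  exists b, forall i, S i -> b < i -> tail_free y (z i).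
Proof.
move=> cy dz; have [[i0 [Si0 ni0]]|h] :=
  pselect (exists i, S i /\ ~ tail_free y (z i)).
  exists i0 => i Si ii0; have [|//|//] := @tail_free_or y (z i) (z i0) cy.
  by move=> /(left_discrete_inj dz Si Si0) e; rewrite e ltxx in ii0.
by exists k0 => i Si _; apply: contrapT => ni; apply: h; exists i.
Qed.

Lemma no_inj_powerset (A : Type) : ~ inj_into (set A) A.
Proof.
move=> [f finj]; pose D := [set a | exists X, f X = a /\ ~ X a].
have [Df|nDf] := pselect (D (f D)); last by apply: (nDf); exists D.
by have [X [/finj -> ]] := Df.
Qed.

(** By comparability [A] injects into [K]. If [K] injects into the power set of [A], it lies between
    the two, and GCH leaves only the upper end. *)
Lemma GCH_powerset_inj (A : Type) : GCH -> inj_into nat A -> ~ inj_into K A ->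
  inj_into (set A) K.
Proof.
move=> gch nA nKA; have [AK|//] := inj_comparable regK A.
have [//|KA] := inj_comparable regK (set A).
by case: (gch A K nA AK KA).
Qed.

(* Jones' lemma: a subset E of a relatively discrete family of size K is determined by the
   trace on the index type P of an open set separating E from the rest of the family, whence
   2^K <= 2^P <= K. *)
Lemma jones (P : Type) (q : P -> G) y (T : set K) : GCH ->
  inj_into nat P -> ~ inj_into K P -> left_discrete y ->
  (forall t, T t -> S t) -> unbounded T ->
  (forall t, T t -> closure (range q) (y t)) -> False.
Proof.
move=> gch nP nKP dy TS uT TQ.
(* Points of [T] that are not limits of [T]: on them left discreteness becomes relative
   discreteness. The least point of [T] beyond any [m] is of this kind. *)
pose T' := [set t | T t /\ exists2 m, m < t & forall s, T s -> s < t -> s <= m].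
have uT' : unbounded T'.
  move=> m; case: (regK) => wo _ _ _.
  have [t [[Tt mt] tmin]] := wo [set t | T t /\ m < t] (uT m).
  exists t; split=> //; split=> //; exists m => // s Ts.
  by apply: contraTT; rewrite -!ltNge -leNgt => ms; apply: tmin.
have [f [finj fT]] := unbounded_inj regK uT'.
have iso k : exists W, [/\ open W, W (y (f k)) & forall j, W (y (f j)) -> j = k].
  have [Tk [m mk mmax]] := fT k; have [W [oW Wk WP]] := dy _ _ (TS _ Tk) mk.
  exists W; split=> // j Wj; have Tj := (fT j).1.
  have [mj] := WP _ (TS _ Tj) Wj; rewrite le_eqVlt => /orP[/eqP/finj//|].
  by move=> /(mmax _ Tj); rewrite leNgt mj.
have /choice[U UP] : forall X : set K, exists U, open U /\ exists V,
    [/\ open V, (forall k, X k -> U (y (f k))),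
        (forall k, ~ X k -> V (y (f k))) & forall g, U g -> ~ V g].
  move=> X; have [||U [V [oU oV XU XV UV]]] := @hereditarily_normal_separated G
    [set y (f k) | k in X] [set y (f k) | k in ~` X] hnG.
  - move=> _ [k Xk <-]; apply/notin_closureP; have [W [oW Wk WP]] := iso k.
    by exists W; split=> // _ [j Xj <-] /WP e; apply: Xj; rewrite e.
  - move=> _ [k Xk <-]; apply/notin_closureP; have [W [oW Wk WP]] := iso k.
    by exists W; split=> // _ [j Xj <-] /WP e; apply: Xk; rewrite -e.
  exists U; split=> //; exists V; split=> // k Xk.
    by apply: XU; exists k.
  by apply: XV; exists k.
pose tr X := [set p | U X (q p)].
have tr_sub X X' : tr X = tr X' -> X `<=` X'.
  move=> e k Xk; apply: contrapT => nX'k.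
  have [oU [_ [_ XU _ _]]] := UP X; have [_ [V [oV _ XV UV]]] := UP X'.
  have [|_ [[p _ <-] [Up Vp]]] := TQ _ (fT k).1 (U X `&` V).
    (* For [k] in [X] but not in [X'], the open set [U X] meets the [V] of [X'] near [y (f k)],
       hence at some [q p], which tells the traces apart. *)
    by apply: open_nbhs_nbhs; split; [exact: openI | split; [exact: XU | exact: XV]].
  by apply: (UV (q p)) => //; have : tr X p by []; rewrite e.
have [h hinj] := GCH_powerset_inj gch nP nKP.
apply: (@no_inj_powerset K); exists (h \o tr) => X X' /hinj e.
by apply/seteqP; split; apply: tr_sub.
Qed.

Lemma eventually_notin_closure y (q : K -> K -> G) (l m : K) : GCH ->
  left_discrete y -> exists b, forall t, S t -> b < t ->
  ~ closure [set q a c | a in [set a | a < l] & c in [set c | c <= m]] (y t).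
Proof.
move=> gch dy; set Q := (X in closure X).
have [[b bP]|uT] := bounded_or_unbounded [set t | S t /\ closure Q (y t)].
  by exists b => t St bt Qt; have := bP t (conj St Qt); rewrite leNgt bt.
(* The increasing sequence [u], bounded by [r], makes the segment below [Order.max l r] infinite, as
   Jones' lemma requires; its square indexes the whole set. *)
have /choice[N NP] := no_max regK; pose u n := iter n N m.
have uinc : {homo u : i j / (i < j)%N >-> i < j}.
  by apply: homo_ltn => [? ? ?|n]; [exact: lt_trans | exact: NP].
have [r ur] := nat_bounded regK u.
have lr a : a < l -> a < Order.max l r by rewrite lt_max => ->.
have mr c : c <= m -> c < Order.max l r.
  by move=> cm; rewrite lt_max (le_lt_trans cm (ur 0%N)) orbT.
have ur' n : u n < Order.max l r by rewrite lt_max ur orbT.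
exfalso; apply: (@jones (initial_segment (Order.max l r) * initial_segment (Order.max l r))
  (fun p => q (sval p.1) (sval p.2)) y _ gch _ _ dy _ uT).
- exists (fun n => (exist _ (u n) (ur' n), exist _ (u n) (ur' n))) => i j [e].
  by have [/uinc|/uinc|//] := ltngtP i j; rewrite e ltxx.
- exact: square_not_inj.
- by move=> t [].
move=> t [_]; apply: closureS => _ [a al [c cm <-]].
by exists (exist _ a (lr a al), exist _ c (mr c cm)).
Qed.

Lemma segment_pigeonhole (l : K) (T : set K) (f : K -> K) : unbounded T ->
  (forall t, T t -> f t < l) ->
  exists g, g < l /\ unbounded [set t | T t /\ f t = g].
Proof.
move=> uT fl; apply: contrapT => ng.
have [g gl|b bP] := @segment_union_bounded _ _ regK l (fun g t => T t /\ f t = g).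
  have [//|u] := bounded_or_unbounded [set t | T t /\ f t = g].
  by case: ng; exists g.
have [t [Tt bt]] := uT b.
by have := bP _ t (fl t Tt) (conj Tt erefl); rewrite leNgt bt.
Qed.

End StationaryFamilies.

(** * Translations in a paratopological group *)

Section ParatopologicalGroup.
Context d (K : orderType d) (G : topologicalType).
Variables (mul : G -> G -> G) (one : G) (inv : G -> G).
Hypothesis pG : paratopological_group mul one inv.
Variable S : set (order_topology K).
Local Open Scope order_scope.
Implicit Types (x y : K -> G) (W : set G).

Lemma mulKl c : cancel (mul c) (mul (inv c)).
Proof. by case: pG => -[mA m1 _ mV _] _ h; rewrite mA mV m1. Qed.

Lemma mulIr c g h : mul g c = mul h c -> g = h.
Proof.
case: pG => -[mA _ m1 _ mV] _ /(congr1 (mul^~ (inv c))).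
by rewrite -!mA mV !m1.
Qed.

Lemma open_mull c W : open W -> open [set h | W (mul c h)].
Proof.
case: pG => _ cm oW; apply: (@open_comp _ _ (fun h => mul c h)) => // h _.
apply: (@continuous_comp _ _ _ (fun h => (c, h)) (fun p : G * G => mul p.1 p.2)).
  by apply: cvg_pair; [exact: cvg_cst | exact: cvg_id].
exact: cm.
Qed.

Lemma open_mulr c W : open W -> open [set h | W (mul h c)].
Proof.
case: pG => _ cm oW; apply: (@open_comp _ _ (fun h => mul h c)) => // h _.
apply: (@continuous_comp _ _ _ (fun h => (h, c)) (fun p : G * G => mul p.1 p.2)).
  by apply: cvg_pair; [exact: cvg_id | exact: cvg_cst].
exact: cm.
Qed.

Lemma left_continuous_mull x c : left_continuous S x ->
  left_continuous S (fun i => mul c (x i)).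
Proof. by move=> cx s W m Ss oW Ws ms; exact: (cx s _ m Ss (open_mull c oW)). Qed.

Lemma left_continuous_mulr x c : left_continuous S x ->
  left_continuous S (fun i => mul (x i) c).
Proof. by move=> cx s W m Ss oW Ws ms; exact: (cx s _ m Ss (open_mulr c oW)). Qed.

Lemma left_discrete_mull x c : left_discrete S x ->
  left_discrete S (fun i => mul c (x i)).
Proof.
move=> dx s m Ss ms; have [W [oW Ws WP]] := dx s m Ss ms.
exists [set h | W (mul (inv c) h)]; split; first exact: open_mull.
  by rewrite /= mulKl.
by move=> t St /=; rewrite mulKl; exact: WP.
Qed.

End ParatopologicalGroup.

(** * Order-theoretic consequences of the embedding *)

Section Embedding.
Context d (K : orderType d) (G : topologicalType).
Hypothesis regK : regular_uncountable_cardinal K.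
Variable S : set (order_topology K).
Local Open Scope order_scope.

Lemma embedding_left_continuous (x : K -> G) :
  {within S, continuous (x : order_topology K -> G)} -> left_continuous S x.
Proof.
move=> /subspace_continuousP cx s W m Ss oW Ws ms.
have : nbhs (s : order_topology K) [set t | S t -> W (x t)].
  exact: (cx s Ss W (open_nbhs_nbhs (conj oW Ws))).
rewrite order_nbhs_itv => -[[l r] [oi]].
rewrite /= itv_boundlr => /andP[ls sr] iW.
(* Only the left end of the interval matters, since [t <= s]; [b] is the larger of it and [m]. *)
have [b [mb bs lb]] : exists b, [/\ m <= b, b < s &
    forall t, b < t -> (l <= BLeft t)%O].
  case: l oi ls {iW} => [[] a|[]] oi ls //; last by exists m.
  exists (Order.max m a); split; first by rewrite le_max lexx.
    by rewrite gt_max ms; move: ls; rewrite bnd_simp.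
  by move=> t; rewrite gt_max bnd_simp => /andP[].
exists b; split=> // t St bt ts.
apply: (iW t) => //=; rewrite itv_boundlr lb //=.
by apply: le_trans sr; rewrite bnd_simp.
Qed.

Lemma embedding_left_discrete (x : K -> G) : {in S &, injective x} ->
  (forall U : set (order_topology K), open U ->
    exists W : set G, open W /\ x @` (S `&` U) = x @` S `&` W) ->
  left_discrete S x.
Proof.
move=> xinj xop s m Ss ms; case: (regK) => wo _ _ _.
have [s' [ss' s'min]] : exists s', s < s' /\ forall t, s < t -> s' <= t.
  by have [q sq] := no_max regK s; apply: (wo [set q | s < q]); exists q.
have [W [oW WE]] := xop _ (@itv_open _ (order_topology K) m s').
exists W; split=> //.
  have : (x @` S `&` W) (x s); last by case.
  by rewrite -WE; exists s => //; split=> //; rewrite /= in_itv /= ms ss'.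
move=> t St Wt; have : (x @` S `&` W) (x t) by split=> //; exists t.
rewrite -WE => -[r [Sr /=]]; rewrite in_itv /= => /andP[mr rs'] e.
have <- : r = t by apply: xinj; rewrite ?inE.
by split=> //; rewrite leNgt; apply/negP => /s'min; rewrite leNgt rs'.
Qed.

End Embedding.

(** * The rows and the two separated sets *)

Section NonSeparableRows.
Local Open Scope order_scope.
Context d (K : orderType d) (G : topologicalType).
Variables (mul : G -> G -> G) (one : G) (inv : G -> G).
Hypothesis gch : GCH.
Hypothesis regK : regular_uncountable_cardinal K.
Hypothesis hnG : hereditarily_normal G.
Hypothesis T1G : accessible_space G.
Hypothesis pG : paratopological_group mul one inv.
Variable S : set (order_topology K).
Hypothesis statS : stationary S.
Variable x : K -> G.
Hypothesis cx : left_continuous S x.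
Hypothesis dx : left_discrete S x.
Variable a0 : K.
Hypothesis Sa0 : S a0.
Hypothesis lim_a0 : forall m, m < a0 -> exists s, [/\ S s, m < s & s < a0].
Variable m0 : K.
Hypothesis m0a0 : m0 < a0.

Let b g i := mul (x g) (x i).
Let y := b a0.

Let cb g : left_continuous S (b g).
Proof. exact: (@left_continuous_mull _ _ _ _ _ _ pG S x (x g) cx). Qed.
Let db g : left_discrete S (b g).
Proof. exact: (@left_discrete_mull _ _ _ _ _ _ pG S x (x g) dx). Qed.
Let cbr i : left_continuous S (b^~ i).
Proof. exact: (@left_continuous_mulr _ _ _ _ _ _ pG S x (x i) cx). Qed.

(* A point where the row y has no tail is avoided uniformly by the tails of all nearby rows. *)
Lemma uniform_tail_avoids h : tail_free S y h ->
  exists g W c, [/\ g < a0, open W, W h &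
    forall g', S g' -> g < g' -> g' < a0 -> tail_avoids S (b g') W c].
Proof.
move=> [W [c [oW Wh av]]].
have [W2 [oW2 W2h W2W]] := shrink_nbhs hnG T1G oW Wh.
have [W3 [oW3 W3h W3W]] := shrink_nbhs hnG T1G oW2 W2h.
have /choice[f fP] : forall j, exists g, S j -> c < j -> g < a0 /\
    forall g', S g' -> g < g' -> g' <= a0 -> ~ W2 (b g' j).
  move=> j; have [[Sj cj]|n] := pselect (S j /\ c < j); last first.
    by exists a0 => Sj cj; case: n.
  have nc : (~` closure W2) (b a0 j) by move=> /W2W; exact: av.
  have [g [_ ga0 gP]] := @cbr j a0 _ m0 Sa0
    (closed_openC (@closed_closure _ W2)) nc m0a0.
  exists g => _ _; split=> // g' Sg' gg' g'a0 W2g.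
  by apply: (gP g' Sg' gg' g'a0); exact: subset_closure.
have uS : unbounded [set j | S j /\ c < j].
  move=> m; have [s [Ss ms _]] :=
    stationary_closed_under regK id (Order.max m c) statS.
  by move: ms; rewrite gt_max => /andP[ms cs]; exists s.
have [t [St ct]] : exists t, S t /\ c < t.
  by have [t [[]]] := uS c; exists t.
(* One [g] serves unboundedly many columns [j], so each row between [g] and [a0] leaves [W2]
   unboundedly often and its tail avoids [W3]. *)
have [g [ga0 ug]] := segment_pigeonhole regK uS (fun t St => (fP t St.1 St.2).1).
have [c' c'P] : exists c', forall g' j, g' < a0 ->
    [/\ S g', g < g', S j & W3 (b g' j)] -> j <= c'.
  apply: (segment_union_bounded regK) => g' g'a0.
  have [[Sg' gg']|n] := pselect (S g' /\ g < g'); last first.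
    by exists a0 => j [? ? _ _]; case: n.
  have u : unbounded [set j | S j /\ ~ W2 (b g' j)].
    move=> m; have [j [[[Sj cj] e] mj]] := ug m; exists j; split=> //; split=> //.
    by apply: (fP j Sj cj).2 => //; [rewrite e | exact: ltW].
  have [c' c'P] := tail_avoids_shrunk regK statS (@cb g') oW2 W3W u.
  exists c' => j [_ _ Sj W3j]; rewrite leNgt; apply/negP => cj.
  exact: (c'P j Sj cj).
exists g, W3, c'; split=> // g' Sg' gg' g'a0 j Sj cj W3j.
by have := c'P g' j g'a0 (And4 Sg' gg' Sj W3j); rewrite leNgt cj.
Qed.

(* Naming: c, c1, c2, c3 are bounds beyond which a property holds, F collects the closure
   conditions on the club, and i0 enumerates the thinned index set of A. *)
Lemma not_hereditarily_normal : False.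
Proof.
have xinj s t : S s -> S t -> x s = x t -> s = t := left_discrete_inj dx.
have [c1 c1P] := eventually_tail_free regK hnG T1G statS m0 (@cb a0) (@db a0).
(* The neighbourhood [N i] of [y i] is missed beyond column [cN i] by all rows between [gm i] and
   [a0]; other indices get dummy values. *)
have /choice[gm /choice[N /choice[cN NP]]] : forall i, exists g W c,
    S i -> c1 < i -> [/\ g < a0, open W, W (y i) &
    forall g', S g' -> g < g' -> g' < a0 -> tail_avoids S (b g') W c].
  move=> i; have [[Si ci]|n] := pselect (S i /\ c1 < i); last first.
    by exists m0, setT, m0 => Si ci; case: n.
  by have [g [W [c P]]] := uniform_tail_avoids (c1P i Si ci); exists g, W, c.
have uS : unbounded [set j | S j /\ c1 < j].
  move=> m; have [s [Ss ms _]] :=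
    stationary_closed_under regK id (Order.max m c1) statS.
  by move: ms; rewrite gt_max => /andP[ms cs]; exists s.
have gma0 i : S i /\ c1 < i -> gm i < a0 by move=> [Si ci]; have [] := NP i Si ci.
have [g1 [g1a0 uI]] := segment_pigeonhole regK uS gma0.
set I := [set t | _ /\ _] in uI.
have [c2 c2P] : exists c2, forall g i, g < a0 ->
    S i /\ ~ tail_free S y (b g i) -> i <= c2.
  apply: (segment_union_bounded regK) => g ga0.
  have [c cP] := eventually_tail_free regK hnG T1G statS m0 (@cb a0) (@db g).
  exists c => i [Si ni]; rewrite leNgt; apply/negP => ci; exact/ni/cP.
have /choice[h hP] : forall m, exists c, forall i, S i -> c < i -> ~ closure
    [set b g j | g in [set g | g < a0] & j in [set j | j <= m]] (y i).
  by move=> m; exact: (eventually_notin_closure regK hnG b a0 m gch (@db a0)).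
have /choice[h' h'P] : forall m, exists c, forall g i, g < a0 ->
    S i /\ closure [set y j | j in [set j | j <= m]] (b g i) -> i <= c.
  move=> m; apply: (segment_union_bounded regK) => g ga0.
  have [c cP] := eventually_notin_closure regK hnG (fun=> y) a0 m gch (@db g).
  exists c => i [Si cli]; rewrite leNgt; apply/negP => ci; apply: (cP i Si ci).
  (* The first index of the constant family is a dummy, and [m0] is a value below [a0]. *)
  by move: cli; apply: closureS => _ [j jm <-]; exists m0 => //; exists j.
have /choice[g' g'P] : forall a, exists c, forall g, g < a0 -> S a -> c2 < a ->
    exists W, [/\ open W, W (b g a) & tail_avoids S y W c].
  move=> a.
  have /choice[f fP] : forall g, exists c, g < a0 -> S a -> c2 < a ->
      exists W, [/\ open W, W (b g a) & tail_avoids S y W c].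
    move=> g; have [[ga0 [Sa ca]]|n] := pselect (g < a0 /\ S a /\ c2 < a); last first.
      by exists m0 => ga0 Sa ca; case: n.
    have [W [c [oW Wa av]]] : tail_free S y (b g a).
      apply: contrapT => nt; have := c2P g a ga0 (conj Sa nt).
      by rewrite leNgt ca.
    by exists c => _ _ _; exists W.
  have [c cP] := segment_bounded regK a0 f.
  exists c => g ga0 Sa ca; have [W [oW Wa av]] := fP g ga0 Sa ca.
  exists W; split=> // i Si ci; apply: av => //.
  exact: lt_trans (cP g ga0) ci.
have /choice[i0 i0P] : forall t, exists i, [/\ I i, t < i, h t < i &
    forall s, s <= t -> g' s < i].
  move=> t; have [t1 tt1] := no_max regK t.
  have [c cP] := segment_bounded regK t1 g'.
  have [i [Ii]] := uI (Order.max t (Order.max (h t) c)).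
  rewrite !gt_max => /and3P[ti hi ci]; exists i; split=> // s st.
  by apply: lt_trans ci; apply: cP; exact: le_lt_trans tt1.
have Si0 t : S (i0 t) by have [[[]]] := i0P t.
have ci0 t : c1 < i0 t by have [[[]]] := i0P t.
pose F t := Order.max (cN (i0 t)) (Order.max (h' t) (i0 t)).
have FP s t : closed_under F s -> t < s ->
    [/\ cN (i0 t) < s, h' t < s & i0 t < s].
  by move=> cs /cs; rewrite !gt_max => /and3P[].
pose A := range (fun t => y (i0 t)).
pose B := [set b g s | g in [set g | [/\ S g, g1 < g & g < a0]] &
  s in [set s | [/\ S s, c2 < s & closed_under F s]]].
(* Near [y (i0 t)], columns [s <= t] are excluded by Jones' lemma through [h t < i0 t], and columns
   [s > t] by [N (i0 t)], since [cN (i0 t) < s]. *)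
have AB z : A z -> ~ closure B z.
  move=> [t _ <-]; apply/notin_closureP.
  have [[_ gmi] ti hi _] := i0P t.
  have [W1 [oW1 W1y W1P]] := (notin_closureP _ _).1 (hP t _ (Si0 t) hi).
  have [_ oN Ny NPt] := NP _ (Si0 t) (ci0 t).
  exists (W1 `&` N (i0 t)); split=> //; first exact: openI.
  move=> _ [g [Sg g1g ga0] [s [Ss c2s cs] <-]] [W1s Ns].
  have [st|ts] := leP s t.
    by apply: W1P W1s; exists g => //; exists s.
  have [cNs _ _] := FP s t cs ts.
  by apply: (NPt g Sg _ ga0 s Ss cNs Ns); rewrite gmi.
(* Near [b g s], the [y (i0 t)] with [t >= s] are excluded by [g' s < i0 t]. For [t < s] also
   [i0 t < s]: indices beyond [c] give points of [V], close to [y s], and those up to [c] fall under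
   Jones' lemma. *)
have BA z : B z -> ~ closure A z.
  move=> [g [Sg g1g ga0] [s [Ss c2s cs] <-]]; apply/notin_closureP.
  have [W1 [oW1 W1b av]] := g'P s g ga0 Ss c2s.
  have neq : b g s <> y s.
    by move=> /(mulIr pG)/(xinj _ _ Sg Sa0) e; rewrite e ltxx in ga0.
  have [U [V [oU oV Ub Vy UV]]] := separated_points hnG T1G neq.
  have [c [_ cs' cP]] := @cb a0 s V c2 Ss oV Vy c2s.
  have [_ h's _] := FP s c cs cs'.
  have [W2 [oW2 W2b W2P]] : exists W, [/\ open W, W (b g s) &
      forall z, [set y j | j in [set j | j <= c]] z -> ~ W z].
    apply/notin_closureP => cl.
    by have := h'P c g s ga0 (conj Ss cl); rewrite leNgt h's.
  exists (W1 `&` (U `&` W2)); split=> //.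
    by apply: openI => //; exact: openI.
  move=> _ [t _ <-] [W1t [Ut W2t]]; have [_ _ _ g't] := i0P t.
  have [st|ts] := leP s t; first exact: (av _ (Si0 t) (g't s st)).
  have [_ _ i0s] := FP s t cs ts.
  have [ic|ci] := leP (i0 t) c; first by apply: W2P W2t; exists (i0 t).
  by apply: UV Ut _; apply: cP => //; exact: ltW.
have [U [V [oU oV AU BV UV]]] := hereditarily_normal_separated hnG AB BA.
(* A row leaving [V] unboundedly often would do so just below some [s] with [b g s] in [B], against
   left continuity at [s]. *)
have [c3 c3P] : exists c3, forall g i, g < a0 ->
    [/\ S g, g1 < g, S i & ~ V (b g i)] -> i <= c3.
  apply: (segment_union_bounded regK) => g ga0.
  have [[Sg g1g]|n] := pselect (S g /\ g1 < g); last first.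
    by exists a0 => j [? ? _ _]; case: n.
  have [[c cP]|/choice[F2 F2P]] :=
      bounded_or_unbounded [set i | S i /\ ~ V (b g i)].
    by exists c => i [_ _ Si nV]; exact: cP.
  have [s [Ss c2s cs]] := stationary_closed_under regK
    (fun t => Order.max (F t) (F2 t)) c2 statS.
  have Vs : V (b g s).
    apply: BV; exists g => //; exists s => //; split=> // t /cs.
    by rewrite gt_max => /andP[].
  have [c [_ cs' cP]] := @cb g s V c2 Ss oV Vs c2s.
  have [[SF nV] cF] := F2P c.
  case: nV; apply: cP => //; apply/ltW.
  by have := cs c cs'; rewrite gt_max => /andP[].
have Uy : U (y (i0 c3)) by apply: AU; exists c3.
(* In column [i0 c3], rows close to [a0] enter [U] by continuity, yet lie in [V] because
   [c3 < i0 c3]. *)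
have [g2 [_ g2a0 g2P]] := @cbr (i0 c3) a0 U m0 Sa0 oU Uy m0a0.
have mx : Order.max g1 g2 < a0 by rewrite gt_max g1a0.
have [g [Sg + ga0]] := lim_a0 mx; rewrite gt_max => /andP[g1g g2g].
have [_ c3i _ _] := i0P c3.
apply: (UV (b g (i0 c3))); first by apply: g2P => //; exact: ltW.
apply: contrapT => nV.
by have := c3P g (i0 c3) ga0 (And4 Sg g1g (Si0 c3) nV); rewrite leNgt c3i.
Qed.

End NonSeparableRows.

Theorem theorem2p5 : GCH ->
  forall (G : topologicalType) (mul : G -> G -> G) (one : G) (inv : G -> G),
    tychonoff_space G -> paratopological_group mul one inv ->
  forall (d : Order.disp_t) (K : orderType d),
    regular_uncountable_cardinal K ->
  forall S : set (order_topology K), stationary S ->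
    embeds_in G S ->
  ~ hereditarily_normal G.
Proof.
move=> gch G mul one inv [T1G _] pG d K regK S statS [x [cx xinj xop]] hnG.
have cx' := embedding_left_continuous cx.
have dx := embedding_left_discrete regK xinj xop.
have [k0 _] := regular_inhabited regK.
have /choice[F FP] : forall m : K, exists s, S s /\ (m < s)%O.
  by move=> m; have [s [Ss ms _]] := stationary_closed_under regK id m statS; exists s.
(* Closure under [F], which picks points of [S] beyond its argument, makes [a0] a limit of [S]. *)
have [a0 [Sa0 k0a0 ca0]] := stationary_closed_under regK F k0 statS.
apply: (not_hereditarily_normal gch regK hnG T1G pG statS cx' dx Sa0 _ k0a0) => m ma0.
by exists (F m); have [SF mF] := FP m; split=> //; exact: ca0.
Qed.
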